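(* Let $B\subseteq A$ be a (unital) inclusion of multimatrix algebras over $\mathbb{C}$ and let $m\geq 1$. The inclusion matrix of $B \subseteq A$ satisfies a depth $2m+1$ inequality if and only if the distance between any two simple $B$-modules is at most $m$.
   Context: A multimatrix algebra is a finite direct product of full matrix algebras over $\mathbb{C}$. Let $V_1,\dots,V_s$ be the simple $A$-modules and $W_1,\dots,W_r$ the simple $B$-modules up to isomorphism; the inclusion matrix is the $r\times s$ matrix $M=(m_{ij})$, where $m_{ij}$ is the multiplicity of $W_i$ in the restriction $V_j\!\downarrow_B$. Powers of $M$ are understood as $M^1=M$, $M^2=MM^t$, $M^3=MM^tM$, etc.; inequalities are entrywise. $M$ satisfies a depth $n$ inequality ($n\ge 2$) if $M^{n+1}\le qM^{n-1}$ for some positive integer $q$. Write $W_i\sim W_j$ if there is a simple $A$-module $V$ such that $W_i$ and $W_j$ are both constituents of $V\!\downarrow_B$, and let $\approx$ be the transitive closure of $\sim$. The distance $d(W_i,W_j)$ is defined as follows: $d(W_i,W_i)=0$; if $i\ne j$ and $W_i\approx W_j$, it is the smallest $k\geq 1$ such that there is a chain $W_i=W_{i_0}\sim W_{i_1}\sim\cdots\sim W_{i_k}=W_j$ of simple $B$-modules; and $d(W_i,W_j)=-\infty$ if $W_i\not\approx W_j$. *)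

(* Defs.v *)
From HB Require Import structures.
From Stdlib Require Import Relation_Operators.
From mathcomp Require Import all_boot all_order all_algebra.
From mathcomp Require Import complex.
From mathcomp Require Import boolp classical_sets reals constructive_ereal.

Set Implicit Arguments.
Unset Strict Implicit.
Unset Printing Implicit Defensive.

Import Order.TTheory GRing.Theory Num.Theory.

Local Open Scope ring_scope.

(* The components g i assemble into one map A -> \prod_i M_(n_i)(C), which is
   a morphism of unital C-algebras because each g i is.  Block sizes are
   positive, and s > 0 is automatic since an algType has 1 != 0. *)
Definition multimatrix (C : fieldType) (A : algType C) : Prop :=
  exists (s : nat) (n : 'I_s -> nat)
         (g : forall i : 'I_s, {lrmorphism A -> 'M[C]_((n i).+1)}),
    bijective (fun (a : A) (i : 'I_s) => g i a).

Section Modules.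
Variable R : pzRingType.

Definition simple_mod (U : lmodType R) : Prop :=
  (exists u : U, u != 0) /\
  (forall N : {pred U}, submod_closed N ->
     (forall u, u \in N -> u = 0) \/ (forall u, u \in N)).

Definition mod_iso (U U' : lmodType R) : Prop :=
  exists f : {linear U -> U'}, bijective f.

(* A finite direct sum is a finite product, so U is isomorphic to the direct
   sum of the S k exactly when linear maps p k make u |-> (p k u)_k bijective. *)
Definition mod_dirsum (U : lmodType R) (n : nat) (S : 'I_n -> lmodType R) :
    Prop :=
  exists p : forall k : 'I_n, {linear U -> S k},
    bijective (fun (u : U) (k : 'I_n) => p k u).

Definition has_multiplicity (W U : lmodType R) (k : nat) : Prop :=
  exists (n : nat) (S : 'I_n -> lmodType R),
    [/\ forall l, simple_mod (S l), mod_dirsum U S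
      & #|[pred l : 'I_n | `[< mod_iso (S l) W >]]| = k].

(* For U semisimple of finite length and W simple, has_multiplicity W U holds
   of exactly one k (Krull-Schmidt); otherwise the default 0 may be returned. *)
Definition multiplicity (W U : lmodType R) : nat :=
  xget 0%N [set k | has_multiplicity W U k].

Definition constituent (W U : lmodType R) : Prop :=
  (0 < multiplicity W U)%N.

Definition simple_mods_up_to_iso (n : nat) (V : 'I_n -> lmodType R) : Prop :=
  [/\ forall i, simple_mod (V i),
      forall i j, mod_iso (V i) (V j) -> i = j
    & forall U : lmodType R, simple_mod U -> exists i, mod_iso U (V i)].

End Modules.

Definition restr_mod (B A : pzRingType) (f : {rmorphism B -> A})
  (V : lmodType A) : Type := V.

Section Restriction.
Variables (B A : pzRingType) (f : {rmorphism B -> A}) (V : lmodType A).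

HB.instance Definition _ := GRing.Zmodule.on (restr_mod f V).

Definition restr_scale (b : B) (v : restr_mod f V) : restr_mod f V :=
  f b *: (v : V).

Fact restr_scaleA a b v :
  restr_scale a (restr_scale b v) = restr_scale (a * b) v.
Proof. by rewrite /restr_scale scalerA rmorphM. Qed.

Fact restr_scale1 : left_id 1 restr_scale.
Proof. by move=> v; rewrite /restr_scale rmorph1 scale1r. Qed.

Fact restr_scaleDr : right_distributive restr_scale +%R.
Proof. by move=> b u v; rewrite /restr_scale scalerDr. Qed.

Fact restr_scaleDl v : {morph restr_scale^~ v : a b / a + b}.
Proof. by move=> a b; rewrite /restr_scale rmorphD scalerDl. Qed.

HB.instance Definition _ := GRing.Zmodule_isLmodule.Build B (restr_mod f V)
  restr_scaleA restr_scale1 restr_scaleDr restr_scaleDl.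

End Restriction.

Section InclusionMatrix.
Variables (B A : pzRingType) (f : {rmorphism B -> A}) (r s : nat).
Variables (W : 'I_r -> lmodType B) (V : 'I_s -> lmodType A).

Definition inclusion_mx : 'M[nat]_(r, s) :=
  \matrix_(i, j) multiplicity (W i) (restr_mod f (V j)).

End InclusionMatrix.

Section Depth.
Variables (r s : nat) (M : 'M[nat]_(r, s)).

(* mx_altpow b k is the power M^(k.*2 + b) in the sense M^1 = M, M^2 = M M^T,
   M^3 = M M^T M, and so on; the parity b of the exponent decides its width. *)
Definition mx_altpow (b : bool) (k : nat) : 'M[nat]_(r, if b then s else r) :=
  (M *m M^T) ^+ k *m
  (if b as b' return 'M[nat]_(r, if b' then s else r) then M else 1%:M).

(* M^(n+1) <= q M^(n-1): both exponents have the parity of n.+1. *)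
Definition depth_inequality (n : nat) : Prop :=
  (2 <= n)%N /\
  exists q : nat, (0 < q)%N /\
    forall i j, (mx_altpow (odd n.+1) n.+1./2 i j
                 <= q * mx_altpow (odd n.+1) n.-1./2 i j)%N.

End Depth.

Section Distance.
Variables (B A : pzRingType) (f : {rmorphism B -> A}).

Definition adjacent (U U' : lmodType B) : Prop :=
  exists V : lmodType A,
    [/\ simple_mod V, constituent U (restr_mod f V)
      & constituent U' (restr_mod f V)].

Variables (r : nat) (W : 'I_r -> lmodType B).

Definition linked : 'I_r -> 'I_r -> Prop :=
  clos_trans 'I_r (fun i j => adjacent (W i) (W j)).

Definition chain (i j : 'I_r) (k : nat) : Prop :=
  exists c : nat -> 'I_r,
    [/\ c 0%N = i, c k = j
      & forall l, (l < k)%N -> adjacent (W (c l)) (W (c l.+1))].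

Lemma linked_chain i j :
  linked i j -> exists k, `[< (1 <= k)%N /\ chain i j k >].
Proof.
move=> ij; suff [k [k1 ck]] : exists k, (1 <= k)%N /\ chain i j k.
  by exists k; apply/asboolP.
elim: ij => {i j} [i j aij|i j l _ [k [k1 [c [ci cj ca]]]]
                  _ [k' [k'1 [c' [cj' cl ca']]]]].
  exists 1%N; split=> //; exists (fun n => if n is 0%N then i else j).
  by split=> // -[].
exists (k + k')%N; split; first exact: leq_trans k1 (leq_addr _ _).
exists (fun n => if (n < k)%N then c n else c' (n - k)%N); split.
- by rewrite k1.
- by rewrite ltnNge leq_addr /= addKn.
move=> n nk; case: (ltnP n k) => [ltnk|lekn].
  case: ltnP => [_|kn1]; first exact: ca.
  have -> : n.+1 = k by apply/eqP; rewrite eqn_leq ltnk.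
  rewrite subnn cj' -cj; have <- : n.+1 = k by apply/eqP; rewrite eqn_leq ltnk.
  exact: ca.
rewrite ltnNge (leq_trans lekn (leqnSn n)) /= subSn //.
by apply: ca'; rewrite ltn_subLR.
Qed.

Definition dist (i j : 'I_r) : \bar int :=
  if i == j then 0%E
  else if pselect (linked i j) is left ij
       then ((ex_minn (linked_chain ij))%:Z)%:E
       else -oo%E.

End Distance.

(* Main.v *)
(* Entry (i, j) of (M M^T)^k is positive exactly when there is a chain of length
   k from W_i to W_j, and since f is injective every W_i is a constituent of
   some restricted simple A-module, so chains can be padded.  As q may be taken
   arbitrarily large, the depth 2m+1 inequality says that every chain of length
   m+1 can be replaced by one of length m, i.e. that distances never exceed m. *)
Require Import Defs.
From HB Require Import structures.
From mathcomp Require Import all_boot all_order all_algebra.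
From mathcomp Require Import complex.
From mathcomp Require Import boolp classical_sets reals constructive_ereal.

Set Implicit Arguments.
Unset Strict Implicit.
Unset Printing Implicit Defensive.

Import Order.TTheory GRing.Theory Num.Theory.

Local Open Scope ring_scope.
Local Open Scope complex_scope.

(** * Schur's lemma and decomposition into simple modules *)

Lemma inj_surj_bijective (T T' : Type) (h : T -> T') :
  injective h -> (forall y, exists x, h x = y) -> bijective h.
Proof.
move=> hI hS; exists (fun y => sval (cid (hS y))) => [x|y].
  by apply: hI; case: cid.
by case: cid.
Qed.

Section ModuleTheory.
Variable R : pzRingType.
Implicit Types U W S : lmodType R.

Lemma mod_iso_trans U U' U'' :
  mod_iso U U' -> mod_iso U' U'' -> mod_iso U U''.
Proof.
move=> [h hB] [h' h'B].
by exists (h' \o h : {linear U -> U''}); apply: bij_comp.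
Qed.

Lemma mod_iso_sym U U' : mod_iso U U' -> mod_iso U' U.
Proof.
move=> [h [k hK kK]].
have kL : linear k.
  by move=> a u v; apply: (can_inj hK); rewrite kK linearP !kK.
pose kl : {linear U' -> U} :=
  HB.pack k (GRing.isLinear.Build R U' U *:%R k kL).
by exists kl; exists h.
Qed.

Lemma schur S W (h : {linear S -> W}) (x : S) :
  simple_mod S -> simple_mod W -> h x != 0 -> mod_iso S W.
Proof.
move=> [_ sS] [_ sW] hx; exists h; apply: inj_surj_bijective.
  apply: raddf_inj => y hy.
  have [] := sS [pred u | h u == 0].
  - split; first by rewrite inE raddf0.
    by move=> a u v; rewrite !inE linearP => /eqP -> /eqP ->; rewrite scaler0 addr0.
  - by apply; rewrite inE hy.
  - by move=> /(_ x); rewrite inE (negPf hx).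
move=> y; have [] := sW [pred w | `[< exists u, h u = w >]].
- split; first by rewrite inE; exists 0; rewrite raddf0.
  move=> a u v; rewrite !inE => -[u' <-] [v' <-].
  by exists (a *: u' + v'); rewrite linearP.
- by move=> /(_ (h x)) h0; move: hx; rewrite h0 ?eqxx // inE; exists x.
- by move=> /(_ y); rewrite inE.
Qed.

Lemma has_multiplicity_iso W U U' k :
  mod_iso U U' -> has_multiplicity W U k -> has_multiplicity W U' k.
Proof.
move=> /mod_iso_sym[h hB] [n [S [sS [p pB] kE]]]; exists n, S; split=> //.
exists (fun l => p l \o h : {linear U' -> S l}).
exact: (bij_comp pB hB).
Qed.

(** Decompositions transport along an isomorphism, so the two sets of candidate multiplicities
    coincide and [xget] picks the same value from both. *)
Lemma constituent_iso W U U' :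
  mod_iso U U' -> constituent W U -> constituent W U'.
Proof.
move=> UU'; rewrite /constituent /multiplicity.
suff -> : [set k | has_multiplicity W U k]%classic
    = [set k | has_multiplicity W U' k]%classic.
  by [].
apply/seteqP; split=> k /=; first exact: has_multiplicity_iso.
exact/has_multiplicity_iso/mod_iso_sym.
Qed.

(** A sum of simple images that need not be direct; the maps [h l] may even vanish. *)
Definition simply_generated U n :=
  exists (S : 'I_n -> lmodType R) (h : forall l, {linear S l -> U}),
    (forall l, simple_mod (S l)) /\
    (forall u, exists x : forall l, S l, u = \sum_l h l (x l)).

(* A generating family of simple modules of minimal size is a direct sum: a
   relation involving the l-th module expresses, by simplicity, all of it
   through the others. *)
Lemma simply_generated_dirsum U n : simply_generated U n ->
  exists k (S : 'I_k -> lmodType R),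
    (forall l, simple_mod (S l)) /\ mod_dirsum U S.
Proof.
move=> gU; have exU : exists n, `[< simply_generated U n >].
  by exists n; apply/asboolP.
case: (ex_minnP exU) => {gU exU}n /asboolP [S [h [sS hS]]] min_n.
exists n, S; split=> //.
have h_inj (z : forall l, S l) : \sum_l h l (z l) = 0 -> forall l, z l = 0.
  move=> z0 l; apply/eqP/negPn/negP => zl.
  (* The [l]-th entries of all relations form a submodule of [S l]. It contains [z l], which is
     nonzero, so it is everything. *)
  have [] := (sS l).2
    [pred y | `[< exists x : forall l, S l, \sum_l h l (x l) = 0 /\ x l = y >]].
  - split.
      rewrite inE; exists (fun=> 0); split=> //.
      by rewrite big1 // => i _; rewrite raddf0.
    move=> a u v; rewrite !inE => -[x [x0 <-]] [y [y0 <-]].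
    exists (fun i => a *: x i + y i); split=> //.
    under eq_bigr do rewrite linearP.
    by rewrite big_split /= -scaler_sumr x0 y0 scaler0 addr0.
  - move=> /(_ (z l)) zl0; move: zl; rewrite zl0 ?eqxx //.
    by rewrite inE; exists z.
  move=> all_l {z z0 zl}.
  case: n S h sS hS min_n l all_l => [|n] S h sS hS min_n l all_l;
    first by case: (l).
  suff /min_n : `[< simply_generated U n >] by rewrite ltnn.
  apply/asboolP; exists (fun i => S (lift l i)), (fun i => h (lift l i)).
  split=> // u; have [x ->] := hS u.
  (* Subtracting a relation whose [l]-th entry is [x l] removes the [l]-th term from the expression
     of [u], against minimality. *)
  have := all_l (x l); rewrite inE => -[y [y0 yl]].
  exists (fun i => x (lift l i) - y (lift l i)).
  under [RHS]eq_bigr do rewrite raddfB.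
  rewrite sumrB [LHS](bigD1_ord l) //=.
  move: y0; rewrite (bigD1_ord l) //= yl => /eqP; rewrite addr_eq0 => /eqP ->.
  by rewrite addrC.
(* Coordinates are picked by choice; [h_inj] makes them unique, hence linear in [u]. *)
pose p l u := sval (cid (hS u)) l.
have pE u : u = \sum_l h l (p l u) by rewrite /p; case: cid.
have pU u (x : forall l, S l) : u = \sum_l h l (x l) -> forall l, p l u = x l.
  move=> ux l; apply/eqP; rewrite -subr_eq0; apply/eqP.
  apply: (h_inj (fun l => p l u - x l)).
  under eq_bigr do rewrite raddfB.
  by rewrite sumrB -pE -ux subrr.
have pL l : linear (p l).
  move=> a u v; apply: (pU _ (fun l => a *: p l u + p l v)).
  under eq_bigr do rewrite linearP.
  by rewrite big_split /= -scaler_sumr -!pE.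
pose q l : {linear U -> S l} :=
  HB.pack (p l) (GRing.isLinear.Build R U (S l) *:%R (p l) (pL l)).
exists q; exists (fun x => \sum_l h l (x l)) => [u|x]; first by rewrite /= -pE.
by apply: functional_extensionality_dep => l; apply: pU.
Qed.

End ModuleTheory.

(** * Column modules of a matrix representation *)

Definition colmod {F : fieldType} {B : pzRingType} {n : nat}
  (rho : {rmorphism B -> 'M[F]_n.+1}) : Type := 'cV[F]_n.+1.

Section ColumnModule.
Variables (F : fieldType) (B : pzRingType) (n : nat).
Variable rho : {rmorphism B -> 'M[F]_n.+1}.

HB.instance Definition _ := GRing.Zmodule.on (colmod rho).

Definition colmod_scale (b : B) (v : colmod rho) : colmod rho :=
  rho b *m (v : 'cV_n.+1).

Fact colmod_scaleA a b v :
  colmod_scale a (colmod_scale b v) = colmod_scale (a * b) v.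
Proof. by rewrite /colmod_scale rmorphM mulmxA. Qed.

Fact colmod_scale1 : left_id 1 colmod_scale.
Proof. by move=> v; rewrite /colmod_scale rmorph1 mul1mx. Qed.

Fact colmod_scaleDr : right_distributive colmod_scale +%R.
Proof. by move=> b u v; rewrite /colmod_scale mulmxDr. Qed.

Fact colmod_scaleDl v : {morph colmod_scale^~ v : a b / a + b}.
Proof. by move=> a b; rewrite /colmod_scale rmorphD mulmxDl. Qed.

HB.instance Definition _ := GRing.Zmodule_isLmodule.Build B (colmod rho)
  colmod_scaleA colmod_scale1 colmod_scaleDr colmod_scaleDl.

(** If the submodule contains [x] with a nonzero [i]-th entry, the rank-one matrix [u] times the
    [i]-th unit row, divided by that entry, sends [x] to any prescribed [u]; surjectivity of [rho]
    realises this matrix in [B]. *)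
Lemma colmod_simple : (forall X, exists b, rho b = X) -> simple_mod (colmod rho).
Proof.
move=> rhoS; split.
  exists (delta_mx 0 0 : 'cV_n.+1); apply/eqP => /matrixP /(_ 0 0).
  by rewrite !mxE => /eqP; rewrite oner_eq0.
move=> N [N0 NZ].
have [all0|] := pselect (forall u, u \in N -> u = 0); first by left.
move=> /existsNP [x /not_implyP [xN /eqP x0]]; right=> u.
have [i xi] : exists i, (x : 'cV_n.+1) i 0 != 0.
  apply: contrapT => /forallNP x_0; move: x0 => /eqP; apply.
  by apply/colP => i; rewrite [RHS]mxE; apply/eqP/negPn/negP/x_0.
have [b bE] := rhoS ((u : 'cV_n.+1) *m
   (((x : 'cV_n.+1) i 0)^-1 *: delta_mx 0 i)).
suff -> : u = b *: x + 0 by apply: NZ.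
rewrite addr0 -[RHS]/(rho b *m (x : 'cV_n.+1)) bE -mulmxA -scalemxAl -rowE.
suff -> : ((x : 'cV_n.+1) i 0)^-1 *: row i (x : 'cV_n.+1) = 1%:M
  by rewrite mulmx1.
by apply/matrixP => j k; rewrite !ord1 !mxE mulVf.
Qed.

End ColumnModule.

(** * Matrix blocks of a multimatrix algebra and their modules *)

Section Blocks.
Variables (F : fieldType) (B : algType F) (s : nat) (n : 'I_s -> nat).
Variable g : forall i : 'I_s, {lrmorphism B -> 'M[F]_((n i).+1)}.
Variable ginv : (forall i : 'I_s, 'M[F]_((n i).+1)) -> B.
Hypothesis gK : cancel (fun (b : B) i => g i b) ginv.
Hypothesis ginvK : cancel ginv (fun (b : B) i => g i b).

Lemma components_inj b c : (forall l, g l b = g l c) -> b = c.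
Proof.
by move=> bc; apply: (can_inj gK); apply: functional_extensionality_dep.
Qed.

Lemma component_ginv x l : g l (ginv x) = x l.
Proof. by rewrite -[RHS](congr1 (fun y => y l) (ginvK x)). Qed.

Definition block l (X : 'M[F]_((n l).+1)) : B :=
  ginv (dfwith (fun k => 0 : 'M[F]_((n k).+1)) X).
Arguments block : clear implicits.

Lemma component_block l X : g l (block l X) = X.
Proof. by rewrite component_ginv dfwith_in. Qed.

Lemma component_block_neq l k X : l != k -> g k (block l X) = 0.
Proof. by move=> lk; rewrite component_ginv dfwith_out. Qed.

Lemma component_surj l X : exists b, g l b = X.
Proof. by exists (block l X); apply: component_block. Qed.

Lemma blockP l b X Y : b * block l X + block l Y = block l (g l b *m X + Y).
Proof.
apply: components_inj => k; rewrite rmorphD rmorphM /=.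
have [<-|lk] := eqVneq l k; first by rewrite !component_block mulmxE.
by rewrite !(component_block_neq _ lk) mulr0 addr0.
Qed.

(** The diagonal matrix units of all blocks are idempotents splitting the identity. *)
Lemma sum_block_delta :
  1 = \sum_(p : {l & 'I_((n l).+1)}) block (tag p) (delta_mx (tagged p) (tagged p)).
Proof.
apply: components_inj => k; rewrite rmorph1 rmorph_sum /=.
rewrite -(sig_big_dep (fun _ => true) (fun _ _ => true)
  (fun l a => g k (block l (delta_mx a a)))) /=.
rewrite (bigD1 k) //= [X in _ + X]big1 ?addr0 => [|l lk].
  by rewrite -[LHS]/(1%:M) mx1_sum_delta; apply: eq_bigr => a _; rewrite component_block.
by rewrite big1 // => a _; rewrite component_block_neq.
Qed.

Section Hom.
Variable U : lmodType B.
Implicit Type u : U.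

(** A column, placed as the [a]-th column of block [l], becomes an element of the left ideal
    generated by the matrix unit at [(a, a)]; this element then acts on [u]. *)
Definition colhom l (a : 'I_((n l).+1)) u (x : colmod (g l)) : U :=
  block l ((x : 'cV_((n l).+1)) *m delta_mx 0 a) *: u.
Arguments colhom : clear implicits.

Fact colhom_linear l a u : linear (colhom l a u).
Proof.
move=> b x y; rewrite /colhom scalerA -scalerDl blockP mulmxA.
by rewrite -mulmxDl.
Qed.

HB.instance Definition _ l a u :=
  GRing.isLinear.Build B (colmod (g l)) U *:%R (colhom l a u)
    (@colhom_linear l a u).

Lemma colhom_delta l a u :
  colhom l a u (delta_mx a 0 : 'cV_((n l).+1)) = block l (delta_mx a a) *: u.
Proof. by rewrite /colhom mul_delta_mx. Qed.

Lemma simple_iso_colmod l a u :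
  simple_mod U -> block l (delta_mx a a) *: u != 0 -> mod_iso (colmod (g l)) U.
Proof.
move=> sU; rewrite -colhom_delta; apply: schur sU.
exact/colmod_simple/component_surj.
Qed.

Lemma block_delta_neq0 u : u != 0 ->
  exists l (a : 'I_((n l).+1)), block l (delta_mx a a) *: u != 0.
Proof.
move=> u0; apply: contrapT => /forallNP b0; move: u0 => /eqP; apply.
rewrite -[u]scale1r sum_block_delta scaler_suml big1 // => -[l a] _ /=.
by have /forallNP /(_ a) /negP /negPn /eqP := b0 l.
Qed.

(** Splitting each coefficient [b t] by [sum_block_delta] writes [U] as a finite sum of images of
    simple column modules, one for each diagonal unit and each generator. *)
Lemma finitely_generated_dirsum (T : finType) (e : T -> U) :
  (forall u, exists b : T -> B, u = \sum_t b t *: e t) ->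
  exists k (S : 'I_k -> lmodType B),
    (forall l, simple_mod (S l)) /\ mod_dirsum U S.
Proof.
move=> eU; pose I : finType := ({l & 'I_((n l).+1)} * T)%type.
apply: (@simply_generated_dirsum _ U #|I|).
pose S (i : I) : lmodType B := colmod (g (tag i.1)).
pose h (i : I) : {linear S i -> U} := colhom (tag i.1) (tagged i.1) (e i.2).
exists (fun l => S (enum_val l)), (fun l => h (enum_val l)).
split=> [l|u]; first exact/colmod_simple/component_surj.
have [b ->] := eU u.
pose x (i : I) : S i := b i.2 *: (delta_mx (tagged i.1) 0 : colmod (g (tag i.1))).
exists (fun l => x (enum_val l)).
rewrite -(big_enum_val (fun i => h i (x i))) /=.
transitivity (\sum_(i : I) h i (x i)); last by apply: eq_bigl.
rewrite -(pair_bigA _ (fun p t => h (p, t) (x (p, t)))) exchange_big /=.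
apply: eq_bigr => t _.
rewrite -[b t in LHS]mulr1 sum_block_delta mulr_sumr scaler_suml.
apply: eq_bigr => p _; rewrite /x /h /= linearZ /= -scalerA.
by rewrite colhom_delta.
Qed.

End Hom.
End Blocks.
Arguments block {F B s n} ginv l X.

(** * Constituents of restricted modules *)

Lemma constituent_gt0 (R : pzRingType) (W U : lmodType R) :
  (exists n (S : 'I_n -> lmodType R),
    (forall l, simple_mod (S l)) /\ mod_dirsum U S) ->
  (forall n (S : 'I_n -> lmodType R), (forall l, simple_mod (S l)) ->
    mod_dirsum U S -> exists l, mod_iso (S l) W) ->
  constituent W U.
Proof.
move=> [n [S [sS US]]] UW; rewrite /constituent /multiplicity.
(* An existing decomposition rules out the default value 0 of [xget]. The value then comes from an
   unspecified decomposition, which is why [UW] ranges over all of them. *)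
have : exists k, has_multiplicity W U k by eexists; exists n, S; split.
move=> /(@xgetPex _ 0%N [set k | has_multiplicity W U k]%classic).
move=> -[n' [S' [sS' US' <-]]]; have [l lW] := UW _ _ sS' US'.
by apply/card_gt0P; exists l; rewrite inE.
Qed.

Lemma mod_iso_restr (B A : pzRingType) (f : {rmorphism B -> A})
    (V V' : lmodType A) :
  mod_iso V V' -> mod_iso (restr_mod f V) (restr_mod f V').
Proof.
move=> [h hB]; pose k : restr_mod f V -> restr_mod f V' := h.
have kL : linear k by move=> b u v; apply: (linearP h (f b) u v).
pose kl : {linear restr_mod f V -> restr_mod f V'} :=
  HB.pack k (GRing.isLinear.Build B _ _ *:%R k kL).
by exists kl.
Qed.

(* An idempotent of B acting non-trivially on W is mapped by f to a non-zero
   element of A, which acts non-trivially on some column module. *)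
Lemma simple_is_constituent (F : fieldType) (A B : algType F)
    (f : {lrmorphism B -> A}) (W : lmodType B) :
  multimatrix A -> multimatrix B -> injective f -> simple_mod W ->
  exists V : lmodType A, simple_mod V /\ constituent W (restr_mod f V).
Proof.
move=> [sA [nA [gA [gAinv gAK gAinvK]]]] [sB [nB [gB [gBinv gBK gBinvK]]]].
move=> f_inj sW; have [[w w0] _] := sW.
have [l [a law]] := block_delta_neq0 gBK gBinvK w0.
set e := block gBinv l (delta_mx a a) in law.
have fe0 : f e != 0.
  by apply: contraNneq law; rewrite -[0](raddf0 f) => /f_inj ->; rewrite scale0r.
have [k gfe0] : exists k, gA k (f e) != 0.
  apply: contrapT => /forallNP g0; move: fe0 => /eqP; apply.
  apply: (components_inj gAK) => k; rewrite raddf0.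
  by apply/eqP/negPn/negP/g0.
pose V : lmodType A := colmod (gA k); exists V; split.
  exact/colmod_simple/(component_surj gAinvK).
have [v v0] : exists v : restr_mod f V, e *: v != 0.
  have /eqP/matrixP/existsNP[i /existsNP[j ij]] := gfe0.
  exists (delta_mx j 0 : 'cV_((nA k).+1)); apply/eqP => /colP /(_ i).
  rewrite -[e *: _]/(gA k (f e) *m delta_mx j 0) -colE !mxE.
  by move: ij; rewrite mxE.
apply: constituent_gt0 => [|n S sS [p [pinv pK _]]].
  apply: (finitely_generated_dirsum gBK gBinvK (U := restr_mod f V)
    (e := fun i : 'I_((nA k).+1) => (delta_mx i 0 : colmod (gA k)))) => u.
  (* Scalars suffice as coefficients: [f] and [gA k] are linear over [F], so [c%:A] acts on columns
     as multiplication by [c]. *)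
  exists (fun i => ((u : 'cV_((nA k).+1)) i 0)%:A).
  rewrite [LHS]matrix_sum_delta; apply: eq_bigr => i _.
  rewrite big_ord1.
  rewrite -[RHS]/(gA k (f _) *m (delta_mx i 0 : 'cV_((nA k).+1))).
  by rewrite !linearZ /= !rmorph1 -scalemxAl mul1mx.
(* Some summand is not killed by [e]; like [W], it is then isomorphic to the column module of block
   [l] of [B]. *)
have [i pi0] : exists i, e *: p i v != 0.
  apply: contrapT => /forallNP p0; move: v0 => /eqP; apply.
  rewrite -(pK (e *: v)) -[RHS]pK; congr pinv.
  apply: functional_extensionality_dep => i.
  by rewrite raddf0 linearZ; apply/eqP/negPn/negP/p0.
exists i.
apply: (mod_iso_trans (mod_iso_sym (simple_iso_colmod gBK gBinvK (sS i) pi0))).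
exact: (simple_iso_colmod gBK gBinvK sW law).
Qed.

(** * Chains and positive entries of matrix powers *)

Lemma mulmx_nat_gt0 p q t (X : 'M[nat]_(p, q)) (Y : 'M[nat]_(q, t)) i j :
  (0 < (X *m Y) i j)%N <-> exists k, (0 < X i k)%N /\ (0 < Y k j)%N.
Proof.
have -> : (X *m Y) i j = (\sum_k X i k * Y k j)%N by rewrite mxE.
rewrite lt0n sum_nat_eq0 negb_forall; split=> [/existsP|] [k].
  by rewrite /= -lt0n muln_gt0 => /andP[]; exists k.
by case=> *; apply/existsP; exists k; rewrite /= -lt0n muln_gt0; apply/andP.
Qed.

Section Chains.
Variables (B A : pzRingType) (f : {rmorphism B -> A}) (r : nat).
Variable W : 'I_r -> lmodType B.
Local Notation chain := (chain f W).
Local Notation adj i j := (adjacent f (W i) (W j)).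

Lemma chain0 i j : chain i j 0 <-> i = j.
Proof. by split=> [[c [<- <-]]|->] //; exists (fun=> j). Qed.

Lemma chainS i j k : chain i j k.+1 <-> exists l, adj i l /\ chain l j k.
Proof.
split=> [[c [<- <- ca]]|[l [il [c [cl cj ca]]]]].
  exists (c 1%N); split; first exact: ca.
  by exists (fun n => c n.+1); split=> // n nk; apply: ca.
exists (fun n => if n is n'.+1 then c n' else i); split=> // -[_|n nk].
  by rewrite cl.
exact: ca.
Qed.

Lemma chain_linked i j k : chain i j k.+1 -> linked f W i j.
Proof.
elim: k i => [|k IH] i /chainS[l [il]].
  by move=> /chain0 <-; left.
by move=> /IH lj; apply: Relation_Operators.t_trans lj; left.
Qed.

Hypothesis adj_refl : forall i, adj i i.

(** Padding repeats the starting point [i], by [adj_refl]. *)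
Lemma chain_leq i j k k' : (k <= k')%N -> chain i j k -> chain i j k'.
Proof.
move=> /subnK <-; elim: (k' - k)%N => [//|d IH] /IH.
by rewrite addSn chainS; exists i.
Qed.

Lemma chain_shorten m : (forall i j, chain i j m.+1 -> chain i j m) ->
  forall k i j, chain i j k -> chain i j m.
Proof.
move=> chm; elim=> [|k IH] i j; first exact: chain_leq.
by move=> /chainS[l [il /IH lj]]; apply: chm; apply/chainS; exists l.
Qed.

(** For unlinked pairs the distance is [-oo] and the bound is free. For linked distinct pairs the
    minimum runs over lengths at least 1, so [0 < m] makes [m] a legitimate candidate. *)
Lemma dist_leP m : (0 < m)%N ->
  (forall i j, (dist f W i j <= m%:Z%:E)%E) <->
  (forall i j, chain i j m.+1 -> chain i j m).
Proof.
move=> m0; split=> [dm i j ij|chm i j]; rewrite ?/dist.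
  have := dm i j; rewrite /dist; case: eqP => [<- _|_].
    by apply: (@chain_leq _ _ 0) => //; apply/chain0.
  case: pselect => [lij|/(_ (chain_linked ij))//].
  case: ex_minnP => k /asboolP[_ ck] _; rewrite lee_fin lez_nat => km.
  exact: chain_leq ck.
case: eqP => [_|_]; first by rewrite lee_fin.
case: pselect => [lij|_]; last exact: leNye.
case: ex_minnP => k /asboolP[_ ck] kmin; rewrite lee_fin lez_nat.
by apply: kmin; apply/asboolP; split=> //; apply: chain_shorten ck.
Qed.

Lemma expmx_gt0_chain (N : 'M[nat]_r) :
  (forall i j, (0 < N i j)%N <-> adj i j) ->
  forall k i j, (0 < (N ^+ k) i j)%N <-> chain i j k.
Proof.
move=> NE; elim=> [|k IH] i j.
  by rewrite expr0 mxE chain0; case: eqP.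
rewrite exprS chainS (mulmx_nat_gt0 N); split=> -[l [il lj]]; exists l; split.
- exact/NE.
- exact/IH.
- exact/NE.
- exact/IH.
Qed.

End Chains.

Lemma depth_inequality_odd r s (M : 'M[nat]_(r, s)) m : (0 < m)%N ->
  depth_inequality M (2 * m + 1) <->
  (forall i j, (0 < ((M *m M^T) ^+ m.+1) i j)%N ->
               (0 < ((M *m M^T) ^+ m) i j)%N).
Proof.
move=> m0; set N := M *m M^T.
have pow k : mx_altpow M false k = N ^+ k by rewrite /mx_altpow mulmx1.
rewrite /depth_inequality.
have -> : odd (2 * m + 1).+1 = false by rewrite addn1 /= mul2n odd_double.
have -> : (2 * m + 1).+1./2 = m.+1 by rewrite addn1 mul2n -doubleS doubleK.
have -> : (2 * m + 1).-1./2 = m by rewrite addn1 mul2n doubleK.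
rewrite !pow; split=> [[_ [q [_ Nq]]] i j Ni|NN].
  by have := leq_trans Ni (Nq i j); rewrite muln_gt0 => /andP[].
split; first by rewrite addn1 ltnS muln_gt0.
(* The sum of all entries dominates each one, and the successor keeps [q] positive even if all
   entries vanish. *)
exists (\sum_i \sum_j (N ^+ m.+1) i j).+1%N; split=> // i j.
have [->//|Ni] := posnP ((N ^+ m.+1) i j).
apply: leq_trans (leq_pmulr _ (NN _ _ Ni)); apply: leqW.
rewrite (bigD1 i) //= (bigD1 j) //= -addnA; exact: leq_addr.
Qed.

Theorem theorem3p9 (R : realType) (A B : algType R[i])
    (hA : multimatrix A) (hB : multimatrix B)
    (f : {lrmorphism B -> A}) (f_inj : injective f)
    (r s : nat) (W : 'I_r -> lmodType B) (V : 'I_s -> lmodType A)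
    (hW : simple_mods_up_to_iso W) (hV : simple_mods_up_to_iso V)
    (m : nat) (hm : (1 <= m)%N) :
  depth_inequality (inclusion_mx f W V) (2 * m + 1)%N <->
  forall i j : 'I_r, (dist f W i j <= m%:Z%:E)%E.
Proof.
have [sW _ _] := hW; have [sV _ Vall] := hV.
(* The multimatrix hypotheses and the injectivity of [f] enter here. *)
have adj_refl i : adjacent f (W i) (W i).
  have [U [sU WU]] := simple_is_constituent hA hB f_inj (sW i).
  by exists U.
set M := inclusion_mx f W V.
have NE i j : (0 < (M *m M^T) i j)%N <-> adjacent f (W i) (W j).
  rewrite mulmx_nat_gt0; split=> [[k []]|[U [sU iU jU]]].
    by rewrite !mxE => ik jk; exists (V k).
  (* [adjacent] ranges over all simple [A]-modules, the columns of [M] only over the representatives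
     [V k]. *)
  have [k /(mod_iso_restr f) Uk] := Vall U sU.
  by exists k; rewrite !mxE; split; apply: constituent_iso Uk _.
rewrite depth_inequality_odd // dist_leP //.
have NP := expmx_gt0_chain NE.
by split=> chm i j; move: (chm i j); rewrite !NP.
Qed.
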